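(* Let $I=(a,b)$ be a bounded interval of the real axis, let $\alpha\in(1/2,3/2)$, $\alpha-1/2<\beta<1$, and $\omega(x)=(x-a)^{\beta}(b-x)^{\beta}$. Consider the left-side Riemann-Liouville fractional integral operator $I_{a+}^{\alpha}$ acting in $L_2(I,\omega)$. Then the following alternative holds: either $I_{a+}^{\alpha}$ is non-simple, or $I_{a+}^{\alpha}$ has an infinite sequence of included invariant subspaces $$\mathfrak{M}_1\supset\mathfrak{M}_2\supset\dots\supset\mathfrak{M}_k\supset\dots$$ (strictly decreasing) having non-zero intersection with both subspaces $L_2^{+}(I,\omega)$ and $L_2^{-}(I,\omega)$, i.e. $\mathfrak{M}_k\cap L_2^{+}(I,\omega)\ne0$ and $\mathfrak{M}_k\cap L_2^{-}(I,\omega)\neq0$ for all $k=1,2,\dots$.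
   Context: $L_2(I,\omega)$ is the complex Hilbert space with inner product $(f,g)_{L_2(I,\omega)}=\int_a^b f\,\overline{g}\,\omega\,dx$. The left-side fractional integral is $(I_{a+}^{\alpha}f)(x)=\frac{1}{\Gamma(\alpha)}\int_a^x f(t)(x-t)^{\alpha-1}\,dt$. Invariant subspaces are closed. An operator is called non-simple if it has a (non-zero) invariant subspace such that the restriction of the operator to this subspace is selfadjoint. The normalized ultraspherical polynomials are $p_n=p_n^{(\beta,\beta)}=\delta_ny_n$, $n\in\mathbb{N}_0$, where $$y_n(x)=(x-a)^{-\beta}(b-x)^{-\beta}\frac{d^n}{dx^n}\left[(x-a)^{\beta+n}(b-x)^{\beta+n}\right],$$ $$\delta_n=(-1)^n\frac{\sqrt{2\beta+2n+1}}{(b-a)^{n+\beta+1/2}}\sqrt{\frac{\Gamma(2\beta+n+1)}{n!\,\Gamma(\beta+n+1)^2}};$$ they form an orthonormal system in $L_2(I,\omega)$. $L_2^{+}(I,\omega)$ and $L_2^{-}(I,\omega)$ denote the closed subspaces of $L_2(I,\omega)$ generated by the even system $\{p_{2k}\}_{k=0}^{\infty}$ and the odd system $\{p_{2k+1}\}_{k=0}^{\infty}$, respectively. *)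

(* Defs.v *)
From HB Require Import structures.
From mathcomp Require Import all_boot all_order all_algebra.
From mathcomp Require Import complex.
From mathcomp Require Import all_classical all_reals all_analysis.

Set Implicit Arguments.
Unset Strict Implicit.
Unset Printing Implicit Defensive.

Import Order.TTheory GRing.Theory Num.Theory.
Import numFieldNormedType.Exports.

Local Open Scope classical_set_scope.
Local Open Scope complex_scope.
Local Open Scope ring_scope.

Definition measurable_funC (R : realType) (D : set R) (f : R -> R[i]) : Prop :=
  measurable_fun D (fun x => complex.Re (f x)) /\
  measurable_fun D (fun x => complex.Im (f x)).

Definition integralC (R : realType) (D : set R) (f : R -> R[i]) : R[i] :=
  (\int[@lebesgue_measure R]_(x in D) complex.Re (f x))%R +i*
  (\int[@lebesgue_measure R]_(x in D) complex.Im (f x))%R.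

(* Elements of the Hilbert space L_2(I, w), I = ]a, b[, are handled through
   representatives [R -> R[i]], of which only the values on I matter up to a
   Lebesgue-null set; subsets of L_2(I, w) are sets of representatives. *)
Definition L2 (R : realType) (a b : R) (w : R -> R) : set (R -> R[i]) :=
  [set f | measurable_funC `]a, b[ f /\
    (\int[@lebesgue_measure R]_(x in `]a, b[)
        (complex.Re (`|f x| ^+ 2) * w x)%:E < +oo)%E].

Definition L2dot (R : realType) (a b : R) (w : R -> R)
    (f g : R -> R[i]) : R[i] :=
  integralC `]a, b[ (fun x => f x * (g x)^* * (w x)%:C).

Definition L2norm (R : realType) (a b : R) (w : R -> R) (f : R -> R[i]) : R :=
  Num.sqrt (complex.Re (L2dot a b w f f)).

Definition ae_eqI (R : realType) (a b : R) (f g : R -> R[i]) : Prop :=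
  {ae @lebesgue_measure R, forall x, x \in `]a, b[ -> f x = g x}.

(* The last clause (M contains its closure in L_2(I, w)) also makes M stable
   under a.e. equality on I, since a.e. equal functions are at distance 0. *)
Definition closed_subspace (R : realType) (a b : R) (w : R -> R)
    (M : set (R -> R[i])) : Prop :=
  [/\ M `<=` L2 a b w,
      M (fun=> 0),
      (forall f g, M f -> M g -> M (fun x => f x + g x)),
      (forall (c : R[i]) f, M f -> M (fun x => c * f x)) &
      (forall f, L2 a b w f ->
        (forall e : R, 0 < e ->
          exists2 g, M g & L2norm a b w (fun x => f x - g x) < e) -> M f)].

Definition nonzero (R : realType) (a b : R) (M : set (R -> R[i])) : Prop :=
  exists2 f, M f & ~ ae_eqI a b f (fun=> 0).

Definition closed_span (R : realType) (a b : R) (w : R -> R)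
    (S : set (R -> R[i])) : set (R -> R[i]) :=
  [set f | L2 a b w f /\
    forall M, closed_subspace a b w M -> S `<=` M -> M f].

Definition invariant_subspace (R : realType) (a b : R) (w : R -> R)
    (A : (R -> R[i]) -> (R -> R[i])) (M : set (R -> R[i])) : Prop :=
  closed_subspace a b w M /\ forall f, M f -> M (A f).

(* For M invariant under A: the graph of the adjoint of the restriction
   A|M : M -> M (left-hand side) is the graph of A|M itself. *)
Definition selfadjoint_restriction (R : realType) (a b : R) (w : R -> R)
    (A : (R -> R[i]) -> (R -> R[i])) (M : set (R -> R[i])) : Prop :=
  forall g h, M g -> M h ->
    (forall f, M f -> L2dot a b w (A f) g = L2dot a b w f h) <->
    ae_eqI a b h (A g).

Definition non_simple (R : realType) (a b : R) (w : R -> R)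
    (A : (R -> R[i]) -> (R -> R[i])) : Prop :=
  exists M, [/\ invariant_subspace a b w A M, nonzero a b M &
                selfadjoint_restriction a b w A M].

(* Euler's integral; only used at s > 0. *)
Definition Gamma (R : realType) (s : R) : R :=
  (\int[@lebesgue_measure R]_(t in `]0%R, +oo[) (t `^ (s - 1) * expR (- t)))%R.

(* Defined for almost every x in I when f is in L_2(I, w); where the integral
   does not exist, the library's total integral gives a junk value. *)
Definition frac_integral (R : realType) (a alpha : R)
    (f : R -> R[i]) : R -> R[i] :=
  fun x => ((Gamma alpha)^-1)%:C *
    integralC `]a, x[ (fun t => f t * ((x - t) `^ (alpha - 1))%:C).

Definition weight (R : realType) (a b beta : R) : R -> R :=
  fun x => (x - a) `^ beta * (b - x) `^ beta.

(* Rodrigues' formula; only its values for x in the open interval I matter, and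
   there [derive1n] does not see the values of [powR] at negative bases. *)
Definition ultra_y (R : realType) (a b beta : R) (n : nat) : R -> R :=
  fun x => (x - a) `^ (- beta) * (b - x) `^ (- beta) *
    derive1n n (fun t => (t - a) `^ (beta + n%:R) * (b - t) `^ (beta + n%:R)) x.

Definition ultra_delta (R : realType) (a b beta : R) (n : nat) : R :=
  (-1) ^+ n *
  (Num.sqrt (2 * beta + 2 * n%:R + 1) / (b - a) `^ (n%:R + beta + 2^-1)) *
  Num.sqrt (Gamma (2 * beta + n%:R + 1) /
            (n`!%:R * Gamma (beta + n%:R + 1) ^+ 2)).

Definition ultra_p (R : realType) (a b beta : R) (n : nat) : R -> R[i] :=
  fun x => (ultra_delta a b beta n * ultra_y a b beta n x)%:C.

Definition L2_plus (R : realType) (a b beta : R) : set (R -> R[i]) :=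
  closed_span a b (weight a b beta)
    (range (fun k : nat => ultra_p a b beta k.*2)).

Definition L2_minus (R : realType) (a b beta : R) : set (R -> R[i]) :=
  closed_span a b (weight a b beta)
    (range (fun k : nat => ultra_p a b beta k.*2.+1)).

(* Main.v *)
Require Import Defs.
From HB Require Import structures.
From mathcomp Require Import all_boot all_order all_algebra.
From mathcomp Require Import complex.
From mathcomp Require Import all_classical all_reals all_analysis.
From mathcomp Require Import measurable_realfun.
From mathcomp Require Import ring lra.
Import Order.TTheory GRing.Theory Num.Theory.
Import numFieldNormedType.Exports.
Local Open Scope classical_set_scope.
Local Open Scope complex_scope.
Local Open Scope ring_scope.

(** The second alternative always holds: a Riemann-Liouville integral starts at
    the left endpoint, so it preserves the space of functions that vanish on
    ]a, c[, whatever [c] is.  With [m] the midpoint of I and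
    [r_k = (b - a) / (2 (k + 2))], the subspaces are
    [M_k = tail_space a b w (m - r_k)], the functions of L_2(I, w) vanishing
    a.e. on ]a, m - r_k[.

    - Invariance ([frac_integral_tail]).  The vanishing of the integral on
      ]a, c[ is obvious, and the point is that it stays in L_2(I, w).  For
      [f] vanishing on ]a, c[ the weight satisfies
      [w t >= (c - a)^beta (b - x)^beta] for [c <= t < x], and
      [|x - t|^(2 alpha - 2)] is integrable because [alpha > 1/2].
      Cauchy-Schwarz then bounds [|I^alpha f (x)|^2] by a constant times
      [(b - x)^(- beta)], a singularity that the factor [w x] absorbs: the
      density [|I^alpha f|^2 w] is even bounded.

    - Strictness and the two intersections.  The bump
      [x |-> max (r_k^2 - (x - m)^2) 0] and its product with [x - m] vanish
      outside ]m - r_k, m + r_k[, hence lie in [M_k]; they do not vanish on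
      ]m - r_k, m - r_(k+1)[, so the first one is not in [M_(k+1)].  The bumps
      are uniform limits of polynomials that are even, respectively odd, about
      [m] ([bump_approx]); this only requires approximating the absolute value
      on [-1, 1], which an explicit recursion does ([abs_poly_bounds]).

    - Identification of the even and odd subspaces.  By the Rodrigues formula
      the n-th ultraspherical polynomial coincides on I with a nonzero multiple
      of a polynomial of degree exactly [n] and of parity [n] about [m]
      ([ultra_yE], [size_Rodrigues_poly], [Rodrigues_poly_reflect]).  A closed
      subspace containing all those of a given parity therefore contains every
      polynomial of that parity ([closed_subspace_poly]), hence the bump of
      that parity ([closed_subspace_bump]).  That the multiple is nonzero rests
      on the Gamma function being finite and positive ([Gamma_gt0]): a
      divergent integral would have been given the value 0. *)

Set Implicit Arguments.
Unset Strict Implicit.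
Unset Printing Implicit Defensive.

(** * The weighted L2 space *)

(** The squared modulus as a real number, where no complex order or norm
    intervenes. *)
Definition sqc {R : realType} (z : R[i]) : R :=
  complex.Re z ^+ 2 + complex.Im z ^+ 2.

Section L2_basics.
Context {R : realType}.
Implicit Types (a b x : R) (w : R -> R) (f g : R -> R[i]).
Local Notation mu := (@lebesgue_measure R).

Lemma sqc_ge0 (z : R[i]) : 0 <= sqc z.
Proof. by rewrite addr_ge0// sqr_ge0. Qed.

Lemma sqc_eq0 (z : R[i]) : (sqc z == 0) = (z == 0).
Proof. by rewrite paddr_eq0 ?sqr_ge0// !sqrf_eq0 eq_complex. Qed.

Lemma Re_normX2 (z : R[i]) : complex.Re (`|z| ^+ 2) = sqc z.
Proof. by rewrite -add_Re2_Im2. Qed.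

Lemma Re_mulJ (z : R[i]) (r : R) : complex.Re (z * z^* * r%:C) = sqc z * r.
Proof. by case: z => x y; rewrite /sqc /=; ring. Qed.

Lemma sqcD_le (y z : R[i]) : sqc (y + z) <= 2 * sqc y + 2 * sqc z.
Proof.
case: y z => [y1 y2] [z1 z2]; rewrite /sqc /=.
have := sqr_ge0 (y1 - z1); have := sqr_ge0 (y2 - z2); nra.
Qed.

Lemma sqcM (y z : R[i]) : sqc (y * z) = sqc y * sqc z.
Proof. by case: y z => [y1 y2] [z1 z2]; rewrite /sqc /=; ring. Qed.

Lemma sqc_real (r : R) : sqc r%:C = r ^+ 2.
Proof. by rewrite /sqc /= expr0n addr0. Qed.

Lemma measurable_sqc D f : measurable_funC D f -> measurable_fun D (sqc \o f).
Proof. by move=> [mr mi]; apply: measurable_funD; exact: measurable_funX. Qed.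

Lemma measurable_funC_add D f g : measurable_funC D f -> measurable_funC D g ->
  measurable_funC D (fun x => f x + g x).
Proof.
move=> [mr mi] [nr ni]; split.
- rewrite [X in measurable_fun _ X](_ : _ =
    (fun x => complex.Re (f x)) \+ (fun x => complex.Re (g x))).
    exact: measurable_funD.
  by apply/funext => x /=; case: (f x) (g x) => [? ?] [? ?].
- rewrite [X in measurable_fun _ X](_ : _ =
    (fun x => complex.Im (f x)) \+ (fun x => complex.Im (g x))).
    exact: measurable_funD.
  by apply/funext => x /=; case: (f x) (g x) => [? ?] [? ?].
Qed.

Lemma measurable_funC_scale D (c : R[i]) f : measurable_funC D f ->
  measurable_funC D (fun x => c * f x).
Proof.
move=> [mr mi]; split.
- rewrite [X in measurable_fun _ X](_ : _ =
    fun x => complex.Re c * complex.Re (f x) - complex.Im c * complex.Im (f x)).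
    by apply: measurable_funB; exact: measurable_funM.
  by apply/funext => x /=; case: c (f x) => [? ?] [? ?].
- rewrite [X in measurable_fun _ X](_ : _ =
    fun x => complex.Re c * complex.Im (f x) + complex.Im c * complex.Re (f x)).
    by apply: measurable_funD; exact: measurable_funM.
  by apply/funext => x /=; case: c (f x) => [? ?] [? ?].
Qed.

Lemma measurable_funC_real D (h : R -> R) : measurable_fun D h ->
  measurable_funC D (fun x => (h x)%:C).
Proof. by move=> mh; split. Qed.

End L2_basics.

Section almost_everywhere.
Context {R : realType}.
Local Notation mu := (@lebesgue_measure R).

Lemma ae_mono (P Q : set R) : P `<=` Q ->
  {ae mu, forall x, P x} -> {ae mu, forall x, Q x}.
Proof. exact: (@filterS _ _ (ae_filter_ringOfSetsType mu)). Qed.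

Lemma ae_mono2 (P Q S : set R) : (forall x, P x -> Q x -> S x) ->
  {ae mu, forall x, P x} -> {ae mu, forall x, Q x} -> {ae mu, forall x, S x}.
Proof. exact: (@filterS2 _ _ (ae_filter_ringOfSetsType mu)). Qed.

Lemma not_ae_on_interval (u v : R) (P : R -> Prop) : u < v ->
  (forall x, x \in `]u, v[ -> ~ P x) -> ~ {ae mu, forall x, P x}.
Proof.
move=> uv nP [N [mN N0 sN]].
have : (mu `]u, v[ <= mu N)%E.
  by apply: le_measure; rewrite ?inE// => x xI; apply: sN => /=; exact: nP.
rewrite N0 lebesgue_measure_itv/= lte_fin uv -EFinD lee_fin; lra.
Qed.

End almost_everywhere.

(** The squared norm in the extended reals: unlike [L2norm], it does not collapse
    a divergent integral to 0. *)
Definition normsq {R : realType} (a b : R) (w : R -> R) (f : R -> R[i]) : \bar R :=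
  (\int[@lebesgue_measure R]_(x in `]a, b[) (sqc (f x) * w x)%:E)%E.

Section weighted.
Context {R : realType} (a b : R) (w : R -> R).
Implicit Types (x : R) (f g : R -> R[i]).
Local Notation mu := (@lebesgue_measure R).
Hypothesis w_ge0 : forall x, x \in `]a, b[ -> 0 <= w x.
Hypothesis mw : measurable_fun `]a, b[ w.

Lemma L2P f : L2 a b w f <->
  measurable_funC `]a, b[ f /\ (normsq a b w f < +oo)%E.
Proof.
suff -> : normsq a b w f =
    (\int[mu]_(x in `]a, b[) (complex.Re (`|f x| ^+ 2) * w x)%:E)%E by [].
apply: eq_integral => x _; congr ((_ * _)%:E).
by apply/esym; exact: Re_normX2.
Qed.

Lemma L2normE f : L2norm a b w f = Num.sqrt (fine (normsq a b w f)).
Proof.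
rewrite /L2norm /L2dot /integralC /=; congr Num.sqrt.
by apply: eq_Rintegral => x _; rewrite Re_mulJ.
Qed.

Lemma measurable_density f : measurable_funC `]a, b[ f ->
  measurable_fun `]a, b[ (fun x => (sqc (f x) * w x)%:E).
Proof.
move=> mf; apply/measurable_EFinP; apply: measurable_funM => //.
exact: measurable_sqc.
Qed.

Lemma density_ge0 f x : `]a, b[%classic x -> (0 <= (sqc (f x) * w x)%:E)%E.
Proof. by move=> xI; rewrite lee_fin mulr_ge0 ?sqc_ge0// w_ge0. Qed.

Lemma normsq_ge0 f : (0 <= normsq a b w f)%E.
Proof. by apply: integral_ge0 => x xI; exact: density_ge0. Qed.

Lemma L2_dominated f g (C : R) : 0 <= C -> L2 a b w g -> measurable_funC `]a, b[ f ->
  (forall x, x \in `]a, b[ -> sqc (f x) <= C * sqc (g x)) -> L2 a b w f.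
Proof.
move=> C0 /L2P[mg gfin] mf fg; apply/L2P; split=> //.
apply: (@le_lt_trans _ _ (C%:E * normsq a b w g)%E).
  rewrite /normsq -ge0_integralZl//; [|exact: measurable_density|exact: density_ge0].
  apply: ge0_le_integral => //; [exact: density_ge0|exact: measurable_density| |].
  + by apply: measurable_funeM; exact: measurable_density.
  + by move=> x xI; rewrite -EFinM lee_fin mulrA ler_wpM2r ?w_ge0// fg.
by rewrite lte_mul_pinfty.
Qed.

Lemma L2_add f g : L2 a b w f -> L2 a b w g -> L2 a b w (fun x => f x + g x).
Proof.
move=> /L2P[mf fi] /L2P[mg gi]; apply/L2P; split.
  exact: measurable_funC_add.
apply: (@le_lt_trans _ _ (2%:E * normsq a b w f + 2%:E * normsq a b w g)%E); last first.
  by apply: lte_add_pinfty; rewrite lte_mul_pinfty.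
rewrite /normsq -!ge0_integralZl//; try exact: measurable_density; try exact: density_ge0.
rewrite -ge0_integralD//=.
- apply: ge0_le_integral => //; [exact: density_ge0| | |].
  + by apply: measurable_density; exact: measurable_funC_add.
  + by apply: emeasurable_funD; apply: measurable_funeM; exact: measurable_density.
  + move=> x xI; rewrite -!EFinM -EFinD lee_fin !mulrA -mulrDl.
    by rewrite ler_wpM2r ?w_ge0// sqcD_le.
- by move=> x xI; rewrite mule_ge0 ?density_ge0.
- by apply: measurable_funeM; exact: measurable_density.
- by move=> x xI; rewrite mule_ge0 ?density_ge0.
- by apply: measurable_funeM; exact: measurable_density.
Qed.

Lemma L2_scale (c : R[i]) f : L2 a b w f -> L2 a b w (fun x => c * f x).
Proof.
move=> fL2; apply: (L2_dominated (sqc_ge0 c) fL2).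
  by apply: measurable_funC_scale; case/L2P: fL2.
by move=> x _; rewrite sqcM.
Qed.

Lemma L2_sub f g : L2 a b w f -> L2 a b w g -> L2 a b w (fun x => f x - g x).
Proof.
move=> fL gL; rewrite (_ : (fun x => _) = (fun x => f x + (-1) * g x)).
  by apply: L2_add => //; exact: L2_scale.
by apply/funext => x; rewrite mulN1r.
Qed.

Lemma L2_0 : L2 a b w (fun=> 0).
Proof.
apply/L2P; split; first by split; exact: measurable_cst.
rewrite /normsq (eq_integral (fun=> 0%E)) ?integral0//.
by move=> x _; rewrite /sqc /= expr0n /= addr0 mul0r.
Qed.

Lemma L2norm_lt f (e : R) : L2 a b w f -> L2norm a b w f < e ->
  (normsq a b w f < (e ^+ 2)%:E)%E.
Proof.
move=> /L2P[_ ffin]; rewrite L2normE => ne.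
have e0 : 0 <= e by rewrite (le_trans _ (ltW ne))// sqrtr_ge0.
have n0 := normsq_ge0 f.
rewrite -[ltLHS]fineK ?ge0_fin_numE// lte_fin.
by rewrite -(sqr_sqrtr (fine_ge0 n0)) ltrXn2r.
Qed.

(** Members of a closed subspace may be redefined off I, being then at distance 0
    from the original; this is how formulas that only hold on I are used. *)
Lemma closed_subspace_eqI M f g : closed_subspace a b w M -> M f ->
  measurable_funC `]a, b[ g -> (forall x, x \in `]a, b[ -> g x = f x) -> M g.
Proof.
move=> [ML2 _ _ _ Mcl] Mf mg gf.
have fL := ML2 _ Mf.
have gL : L2 a b w g.
  apply: (L2_dominated ler01 fL) => // x xI.
  by rewrite gf// mul1r.
apply: Mcl => // e e0; exists f => //.
rewrite L2normE /normsq (eq_integral (fun=> 0%E)) ?integral0 /= ?sqrtr0//.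
move=> x; rewrite inE => xI.
by rewrite gf ?subrr// /sqc /= expr0n /= addr0 mul0r.
Qed.

End weighted.

Definition tail_space {R : realType} (a b : R) (w : R -> R) (c : R) :
    set (R -> R[i]) :=
  [set f | L2 a b w f /\
    {ae @lebesgue_measure R, forall x, x \in `]a, c[ -> f x = 0}].

Section tail_space.
Context {R : realType} (a b c : R) (w : R -> R).
Local Notation mu := (@lebesgue_measure R).
Hypothesis w_gt0 : forall x, x \in `]a, b[ -> 0 < w x.
Hypothesis mw : measurable_fun `]a, b[ w.
Hypothesis cb : c <= b.

Let w_ge0 x : x \in `]a, b[ -> 0 <= w x.
Proof. by move=> /w_gt0/ltW. Qed.

Let sub_acb : `]a, c[ `<=` `]a, b[.
Proof. by apply: subset_itvl; rewrite bnd_simp. Qed.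

Let measurable_density_ac f : measurable_funC `]a, b[ f ->
  measurable_fun `]a, c[ (fun x => (sqc (f x) * w x)%:E).
Proof.
move=> mf; apply: (@measurable_funS _ _ _ _ `]a, b[%classic) => //.
exact: measurable_density.
Qed.

(** If [f] is approached by functions [g] vanishing on ]a, c[, then
    [\int_(]a, c[) |f|^2 w <= ||f - g||^2] is as small as desired, so [f]
    vanishes a.e. there because the weight is positive. *)
Lemma tail_space_closed : closed_subspace a b w (tail_space a b w c).
Proof.
split.
- by move=> f [].
- by split; [exact: L2_0|exact: aeW].
- move=> f g [fL f0] [gL g0]; split; first exact: L2_add.
  by apply: ae_mono2 f0 g0 => x fx gx xI; rewrite fx ?gx ?addr0.
- move=> k f [fL f0]; split; first exact: L2_scale.
  by apply: ae_mono f0 => x fx xI; rewrite fx ?mulr0.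
move=> f fL fcl; split => //.
have mf : measurable_funC `]a, b[ f by case/L2P: fL.
pose dens x := (sqc (f x) * w x)%:E.
have dens0 x : `]a, c[%classic x -> (0 <= dens x)%E.
  by move=> xI; exact: (density_ge0 w_ge0 f (sub_acb xI)).
have int0 : (\int[mu]_(x in `]a, c[) dens x = 0)%E.
  apply/eqP; rewrite eq_le integral_ge0// andbT leNgt; apply/negP => I_gt0.
  have I_fin : (\int[mu]_(x in `]a, c[) dens x)%E \is a fin_num.
    rewrite ge0_fin_numE ?integral_ge0//.
    case/L2P: fL => _; apply: le_lt_trans; rewrite /normsq.
    apply: ge0_subset_integral => //; first exact: measurable_density.
    by move=> x xI; exact: (density_ge0 w_ge0 f xI).
  have I_gt0' : 0 < fine (\int[mu]_(x in `]a, c[) dens x)%E.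
    by rewrite fine_gt0// I_gt0 -ge0_fin_numE// integral_ge0.
  (* Were the integral positive, its square root would be an admissible radius. *)
  have /fcl[g [gL g0]] : 0 < Num.sqrt (fine (\int[mu]_(x in `]a, c[) dens x)%E).
    by rewrite sqrtr_gt0.
  move=> /(L2norm_lt w_ge0 (L2_sub w_ge0 mw fL gL)).
  rewrite sqr_sqrtr ?ltW// fineK// ltNge => /negP; apply.
  have mfg : measurable_funC `]a, b[ (fun x => f x - g x).
    by case/L2P: (L2_sub w_ge0 mw fL gL).
  apply: (@le_trans _ _
      (\int[mu]_(x in `]a, c[) (sqc (f x - g x) * w x)%:E)%E).
    apply: ae_ge0_le_integral => //.
    + exact: measurable_density_ac.
    + by move=> x xI; exact: (density_ge0 w_ge0 (fun x => f x - g x) (sub_acb xI)).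
    + exact: (measurable_density_ac mfg).
    + by apply: ae_mono g0 => x gx xI; rewrite gx// subr0.
  apply: ge0_subset_integral => //; first exact: (measurable_density mw mfg).
  by move=> x xI; exact: (density_ge0 w_ge0 (fun x => f x - g x)).
have mdens : measurable_fun `]a, c[ dens by exact: measurable_density_ac.
have /(ae_eq_integral_abs mu _ mdens).1 : (\int[mu]_(x in `]a, c[) `|dens x| = 0)%E.
  rewrite -int0; apply: eq_integral => x; rewrite inE => xI.
  by rewrite gee0_abs ?dens0.
move=> /(_ (measurable_itv _)); apply: ae_mono => x dx xI; apply/eqP.
have /eqP := dx xI; rewrite /dens eqe mulf_eq0 sqc_eq0 => /orP[//|].
by rewrite gt_eqF// w_gt0//; exact: (sub_acb xI).
Qed.

End tail_space.

Lemma tail_spaceS (R : realType) (a b : R) (w : R -> R) (c c' : R) : c <= c' ->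
  tail_space a b w c' `<=` tail_space a b w c.
Proof.
move=> cc' f [fL f0]; split => //; apply: ae_mono f0 => x fx xac; apply: fx.
by apply: subset_itvl xac; rewrite bnd_simp.
Qed.

Section uniform_approximation.
Context {R : realType} (a b : R) (w : R -> R) (W : R).
Local Notation mu := (@lebesgue_measure R).
Hypothesis ab : a < b.
Hypothesis w_ge0 : forall x, x \in `]a, b[ -> 0 <= w x.
Hypothesis mw : measurable_fun `]a, b[ w.
Hypothesis w_le : forall x, x \in `]a, b[ -> w x <= W.

Lemma normsq_bounded f (K : R) : measurable_funC `]a, b[ f ->
  (forall x, x \in `]a, b[ -> sqc (f x) <= K) ->
  (normsq a b w f <= (K * W * (b - a))%:E)%E.
Proof.
move=> mf fK.
have := lebesgue_measure_itv `]a, b[; rewrite /= lte_fin ab -EFinD => muI.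
rewrite EFinM -muI -(integral_cst mu) //.
apply: ge0_le_integral => //; [exact: density_ge0|exact: measurable_density|].
move=> x xI; rewrite lee_fin ler_pM ?sqc_ge0 ?w_ge0 ?w_le//.
exact: fK.
Qed.

Lemma L2_bounded f (K : R) : measurable_funC `]a, b[ f ->
  (forall x, x \in `]a, b[ -> sqc (f x) <= K) -> L2 a b w f.
Proof.
move=> mf fK; apply/L2P; split => //.
by apply: le_lt_trans (normsq_bounded mf fK) _; rewrite ltry.
Qed.

(** On a bounded interval with bounded weight, uniform convergence implies
    convergence in the weighted L2 norm. *)
Lemma closed_subspace_uniform M (f : R -> R[i]) : closed_subspace a b w M ->
  L2 a b w f ->
  (forall e : R, 0 < e ->
    exists2 g, M g & forall x, x \in `]a, b[ -> sqc (f x - g x) <= e) -> M f.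
Proof.
move=> [ML _ _ _ Mcl] fL approx; apply: Mcl => // e e0.
have W0 : 0 <= W.
  have mI : (a + b) / 2 \in `]a, b[ by rewrite in_itv/= !midf_lt.
  exact: le_trans (w_ge0 mI) (w_le mI).
have Wab0 : 0 < W * (b - a) + 1.
  by rewrite ltr_wpDl// mulr_ge0// subr_ge0 ltW.
(* The extra 1 keeps the denominator positive and the final inequality strict. *)
have /approx[g Mg fg] : 0 < e ^+ 2 / (W * (b - a) + 1).
  by rewrite divr_gt0 ?exprn_gt0.
exists g => //; rewrite L2normE.
have fgL := L2_sub w_ge0 mw fL (ML _ Mg).
have mfg : measurable_funC `]a, b[ (fun x => f x - g x) by case/L2P: fgL.
have bd := normsq_bounded mfg fg.
have n0 := normsq_ge0 w_ge0 (fun x => f x - g x).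
have e0' : 0 < e ^+ 2 by rewrite exprn_gt0.
rewrite -[ltRHS](gtr0_norm e0) -sqrtr_sqr.
rewrite ltr_sqrt// -lte_fin fineK; last first.
  by rewrite ge0_fin_numE// (le_lt_trans bd)// ltry.
apply: le_lt_trans bd _; rewrite lte_fin.
suff : e ^+ 2 / (W * (b - a) + 1) * (W * (b - a)) < e ^+ 2 by rewrite mulrA.
set V := W * (b - a) in Wab0 *.
have : e ^+ 2 = e ^+ 2 / (V + 1) * (V + 1) by rewrite divfK// gt_eqF.
have : 0 < e ^+ 2 / (V + 1) by rewrite divr_gt0.
nra.
Qed.

End uniform_approximation.

(** * Power functions with an endpoint singularity *)

Section power_singularity.
Context {R : realType}.
Local Notation mu := (@lebesgue_measure R).

Lemma is_derive_powR_sub (x p t : R) : t < x ->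
  is_derive t 1 (fun t : R => (x - t) `^ p) (- (p * (x - t) `^ (p - 1))).
Proof.
move=> tx.
have xt : 0 < x - t by rewrite subr_gt0.
have dp := @is_derive1_powR R p (x - t) xt.
have ds : is_derive t 1 (fun t : R => x - t) (- 1).
  by apply: is_derive_eq; rewrite add0r mul1r.
have := @is_derive1_comp R (fun y => y `^ p) (fun t => x - t) t _ _ dp ds.
by rewrite mulrN1.
Qed.

Lemma continuous_powR_sub (x p t : R) : t < x ->
  {for t, continuous (fun t : R => (x - t) `^ p)}.
Proof.
move=> tx; have [+ _] := is_derive_powR_sub p tx.
by move=> /derivable1_diffP /differentiable_continuous.
Qed.

Lemma measurable_powR_sub (x p : R) (D : set R) :
  measurable_fun D (fun t : R => (x - t) `^ p).
Proof.
apply: measurable_funTS.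
apply: (@measurableT_comp _ _ _ _ _ _ (fun y : R => y `^ p)).
  exact: measurable_powR.
exact: measurable_funB.
Qed.

Lemma integral_powR_sub_le (a x y p : R) : -1 < p -> a < y -> y < x ->
  (\int[mu]_(t in `[a, y]) ((x - t) `^ p)%:E
     <= ((x - a) `^ (p + 1) / (p + 1))%:E)%E.
Proof.
move=> p1 ay yx.
have p10 : 0 < p + 1 by rewrite -ltrBlDr sub0r.
pose F t : R := - (x - t) `^ (p + 1) / (p + 1).
have dF t : t < x -> is_derive t 1 F ((x - t) `^ p).
  move=> tx.
  have d := is_derive_powR_sub (p + 1) tx.
  rewrite (_ : F = (fun t : R => (x - t) `^ (p + 1)) * cst (- (p + 1)^-1)); last first.
    by apply/funext => z; rewrite /F mulNr -mulrN.
  apply: is_derive_eq.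
  rewrite scaler0 add0r /GRing.scale /= addrK mulrNN mulrA mulVf ?mul1r//.
  by rewrite gt_eqF.
have cF t : t < x -> {for t, continuous F}.
  by move=> /dF[+ _]; move=> /derivable1_diffP /differentiable_continuous.
rewrite (continuous_FTC2 ay (F := F)) //.
- rewrite -EFinB lee_fin /F mulNr mulNr opprK addrC.
  by rewrite gerBl divr_ge0 ?powR_ge0// ltW.
- apply: continuous_in_subspaceT => t; rewrite inE/= in_itv/= => /andP[_ ty].
  by apply: continuous_powR_sub; exact: le_lt_trans yx.
- split.
  + move=> t; rewrite in_itv/= => /andP[_ ty].
    by have [] := dF _ (lt_trans ty yx).
  + by apply: cvg_at_right_filter; apply: cF; exact: lt_trans yx.
  + by apply: cvg_at_left_filter; exact: cF.
- move=> t; rewrite in_itv/= => /andP[_ ty].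
  by rewrite derive1E; have [_ ->] := dF _ (lt_trans ty yx).
Qed.

(** For [p < 0] the integrand is unbounded at [x], so the fundamental theorem of
    calculus is applied on [a, x - (x - a) / (n + 2)], and [n] tends to infinity
    by monotone convergence. *)
Lemma integral_powR_singular_le (a x p : R) : -1 < p -> a < x ->
  (\int[mu]_(t in `]a, x[) ((x - t) `^ p)%:E
     <= ((x - a) `^ (p + 1) / (p + 1))%:E)%E.
Proof.
move=> p1 ax.
pose y n : R := x - (x - a) / n.+2%:R.
have xa0 : 0 < x - a by rewrite subr_gt0.
have ay n : a < y n.
  rewrite /y ltrBrDr -ltrBrDl ltr_pdivrMr ?ltr0n// ltr_pMr//.
  by rewrite ltr1n.
have yx n : y n < x by rewrite /y gtrBl divr_gt0.
have mf (D : set R) : measurable_fun D (fun t : R => ((x - t) `^ p)%:E).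
  by apply/measurable_EFinP; exact: measurable_powR_sub.
have cup : `]a, x[ `<=` \bigcup_n `[a, y n]%classic.
  move=> t /=; rewrite in_itv/= => /andP[at_ tx].
  have xt0 : 0 < x - t by rewrite subr_gt0.
  exists (Num.truncn ((x - a) / (x - t))) => //=.
  rewrite in_itv/= ltW//= /y lerBrDr -lerBrDl.
  rewrite ler_pdivrMr ?ltr0n// mulrC -ler_pdivrMr// ltW//.
  apply: (lt_le_trans (truncnS_gt _)).
  by rewrite ler_nat.
apply: (@le_trans _ _ (\int[mu]_(t in \bigcup_n `[a, y n]%classic) ((x - t) `^ p)%:E)%E).
  apply: ge0_subset_integral => //.
    by apply: bigcup_measurable => k _; exact: measurable_itv.
    exact: mf.
  by move=> t _; rewrite lee_fin powR_ge0.
have cv := @ge0_nondecreasing_set_cvg_integral _ (measurableTypeR R) R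
  (fun n => `[a, y n]%classic) (fun t => ((x - t) `^ p)%:E) mu.
have {}cv := cv _ (fun n => measurable_itv _) (fun n => mf _) _.
have ndF : {homo (fun n : nat => `[a, y n]%classic) : n m / (n <= m)%N >-> (n <= m)%O}.
  move=> m n mn; rewrite subsetEset; apply: subset_itvl; rewrite bnd_simp.
  by rewrite /y lerD2l lerN2 ler_pM2l// lef_pV2 ?posrE ?ltr0n// ler_nat !ltnS.
have {}cv := cv ndF (fun n t _ => powR_ge0 _ _).
rewrite -(cvg_lim _ cv)//; apply: lime_le; first by apply/cvg_ex; eexists; exact: cv.
by apply: nearW => n; exact: integral_powR_sub_le.
Qed.

End power_singularity.

(** * Boundedness of the fractional integral away from the left endpoint *)

Section weight.
Context {R : realType} (a b beta : R).
Hypothesis beta_ge0 : 0 <= beta.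

Lemma weight_gt0 x : x \in `]a, b[ -> 0 < weight a b beta x.
Proof.
by rewrite in_itv/= => /andP[ax xb]; rewrite mulr_gt0 ?powR_gt0 ?subr_gt0.
Qed.

Lemma weight_ge0 x : x \in `]a, b[ -> 0 <= weight a b beta x.
Proof. by move=> /weight_gt0/ltW. Qed.

Lemma measurable_weight (D : set R) : measurable_fun D (weight a b beta).
Proof.
apply: measurable_funM; last exact: measurable_powR_sub.
apply: measurable_funTS.
apply: (@measurableT_comp _ _ _ _ _ _ (fun y : R => y `^ beta)).
  exact: measurable_powR.
exact: measurable_funB.
Qed.

Lemma weight_le x : x \in `]a, b[ ->
  weight a b beta x <= (b - a) `^ beta * (b - a) `^ beta.
Proof.
rewrite in_itv/= => /andP[ax xb].
have ab := lt_trans ax xb.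
by rewrite /weight ler_pM ?powR_ge0// ge0_ler_powR ?nnegrE//; lra.
Qed.

End weight.

Section frac_integral.
Context {R : realType} (a b : R).
Local Notation mu := (@lebesgue_measure R).

(** Once the kernel is extended by 0 to the whole plane, the integral is the
    difference of the integrals of the positive and negative parts, both
    measurable in [x] by Tonelli's theorem. *)
Lemma measurable_Volterra (p : R) (u : R -> R) : measurable_fun `]a, b[ u ->
  measurable_fun `]a, b[ (fun x => \int[mu]_(t in `]a, x[) (u t * (x - t) `^ p)).
Proof.
move=> um.
pose U := u \_ `]a, b[.
have mU : measurable_fun [set: R] U.
  by apply/(measurable_restrictT _ _).1.
pose h (z : R * R) : R := if z.2 < z.1 then U z.2 * (z.1 - z.2) `^ p else 0.
have mh : measurable_fun [set: R * R] h.
  apply: measurable_fun_ifT => //.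
  - exact: measurable_fun_ltr.
  - apply: measurable_funM; first exact: measurableT_comp.
    apply: (@measurableT_comp _ _ _ _ _ _ (fun y : R => y `^ p)).
      exact: measurable_powR.
    exact: measurable_funB.
have mEh : measurable_fun [set: R * R] (EFin \o h) by apply/measurable_EFinP.
have mp := @measurable_fun_fubini_tonelli_F _ _ _ _ R mu _ (measurable_funepos mEh)
  (fun z => funepos_ge0 _ _).
have mn := @measurable_fun_fubini_tonelli_F _ _ _ _ R mu _ (measurable_funeneg mEh)
  (fun z => funeneg_ge0 _ _).
have m0 : measurable_fun [set: R]
    (fun x => fine (\int[mu]_t (h (x, t))%:E)%E).
  apply: (@measurableT_comp _ _ _ _ _ _ fine).
    exact: fine_measurable.
  rewrite [X in measurable_fun _ X](_ : _ =
    (fubini_F mu (EFin \o h)^\+ \- fubini_F mu (EFin \o h)^\-)%E).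
    exact: emeasurable_funB.
  apply/funext => x; rewrite integralE /fubini_F.
  by congr (_ - _)%E; apply: eq_integral => t _; rewrite ?(funeposE, funenegE).
apply: (@eq_measurable_fun _ _ _ _ _ (fun x => fine (\int[mu]_t (h (x, t))%:E)%E)).
  move=> x; rewrite inE/= in_itv/= => /andP[ax xb].
  rewrite Rintegral_mkcond; congr fine; apply: eq_integral => t _.
  congr (_%:E); rewrite /h /U !patchE /= !mem_setE !in_itv/=.
  case: ltP => [tx|xt]; rewrite ?andbF//.
  rewrite (lt_trans tx xb) !andbT; case: ifP => // _.
  by rewrite mul0r.
exact: measurable_funTS.
Qed.

End frac_integral.

Lemma normr_fine_le (R : realType) (y : \bar R) (C : R) :
  (`|y| <= C%:E)%E -> `|fine y| <= C.
Proof. by case: y => [r| |] //=; rewrite ?lee_fin// leye_eq. Qed.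

Section kernel_bound.
Context {R : realType} (a b c alpha beta : R).
Local Notation mu := (@lebesgue_measure R).
Local Notation w := (weight a b beta).
Hypothesis alpha_gt : 1 / 2 < alpha.
Hypothesis beta_ge0 : 0 <= beta.
Hypothesis ac : a < c.
Hypothesis cb : c < b.

(** The bound produced by [Volterra_AMGM], where [N] is a bound on the squared
    norm of the integrated function. *)
Definition Volterra_const (N : R) : R :=
  N + ((c - a) `^ beta)^-1 * ((b - a) `^ (2 * alpha - 1) / (2 * alpha - 1)).

(** Cauchy-Schwarz for the product of [u] and the kernel, in pointwise form: with
    [A = |u|], [V] the kernel, [r = (b - x)^(beta / 2)] and [s = (c - a)^beta],
    the weight is at least [s r^2] and [2 A V s r <= (A s r)^2 + V^2].  The
    factor [1 / r] is chosen so that its square is compensated by [w x]. *)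
Lemma Volterra_AMGM (x t u : R) : c < x -> x < b -> t < x -> (t < c -> u = 0) ->
  `|u * (x - t) `^ (alpha - 1)| <= (2 * (b - x) `^ (beta / 2))^-1 *
    (u ^+ 2 * w t + ((c - a) `^ beta)^-1 * (x - t) `^ (2 * alpha - 2)).
Proof.
move=> cx xb tx u0; have [ac' cb'] := (ac, cb).
set r := (b - x) `^ (beta / 2); set s := (c - a) `^ beta.
have r0 : 0 < r by rewrite powR_gt0// subr_gt0.
have s0 : 0 < s by rewrite powR_gt0// subr_gt0.
set V := (x - t) `^ (alpha - 1).
have V0 : 0 <= V by rewrite powR_ge0.
have -> : (x - t) `^ (2 * alpha - 2) = V ^+ 2.
  rewrite /V -powR_mulrn ?powR_ge0// -powRrM; congr (_ `^ _); lra.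
have [tc|ct] := ltP t c.
  rewrite u0// mul0r normr0 expr0n/= mul0r add0r.
  apply: mulr_ge0; first by rewrite invr_ge0 mulr_ge0// ltW.
  by apply: mulr_ge0; rewrite ?invr_ge0 ?exprn_ge0// ltW.
rewrite normrM (ger0_norm V0) -[u ^+ 2]real_normK ?num_real//.
set A := `|u|; have A0 : 0 <= A by rewrite /A.
have wt : s * r ^+ 2 <= w t.
  have -> : r ^+ 2 = (b - x) `^ beta.
    rewrite /r -powR_mulrn ?powR_ge0// -powRrM; congr (_ `^ _); lra.
  apply: ler_pM; rewrite ?powR_ge0//; apply: ge0_ler_powR; rewrite ?nnegrE//; lra.
rewrite ler_pdivlMl ?mulr_gt0//.
apply: (@le_trans _ _ (A ^+ 2 * (s * r ^+ 2) + s^-1 * V ^+ 2)); last first.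
  by rewrite lerD2r ler_wpM2l ?exprn_ge0.
rewrite -(ler_pM2l s0) mulrDr mulVKf ?gt_eqF//.
have := sqr_ge0 (A * s * r - V); nra.
Qed.

Lemma Volterra_bound (x N : R) (u : R -> R) : x \in `]c, b[ ->
  measurable_fun `]a, b[ u ->
  {ae mu, forall t, t \in `]a, c[ -> u t = 0} ->
  (\int[mu]_(t in `]a, b[) (u t ^+ 2 * w t)%:E <= N%:E)%E ->
  `|\int[mu]_(t in `]a, x[) (u t * (x - t) `^ (alpha - 1))|
    <= (2 * (b - x) `^ (beta / 2))^-1 * Volterra_const N.
Proof.
rewrite in_itv/= => /andP[cx xb] um u0 uN; apply: normr_fine_le.
have ax := lt_trans ac cx; have alpha_gt' := alpha_gt.
have sub : `]a, x[ `<=` `]a, b[ by apply: subset_itvl; rewrite bnd_simp ltW.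
have umx : measurable_fun `]a, x[ u by apply: measurable_funS um.
have muV : measurable_fun `]a, x[ (fun t => (u t * (x - t) `^ (alpha - 1))%:E).
  by apply/measurable_EFinP/measurable_funM => //; exact: measurable_powR_sub.
apply: le_trans (le_abse_integral mu _ muV) _ => //.
set k := (2 * (b - x) `^ (beta / 2))^-1; set s := ((c - a) `^ beta)^-1.
have k0 : 0 <= k by rewrite invr_ge0 mulr_ge0 ?powR_ge0.
have s0 : 0 <= s by rewrite invr_ge0 powR_ge0.
have muw : measurable_fun `]a, b[ (fun t => (u t ^+ 2 * w t)%:E).
  apply/measurable_EFinP/measurable_funM; first exact: measurable_funX.
  exact: measurable_weight.
have muwx : measurable_fun `]a, x[ (fun t => (u t ^+ 2 * w t)%:E).
  exact: measurable_funS muw.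
have mV : measurable_fun `]a, x[ (fun t => ((x - t) `^ (2 * alpha - 2))%:E).
  by apply/measurable_EFinP; exact: measurable_powR_sub.
have uw0 t : `]a, b[%classic t -> (0 <= (u t ^+ 2 * w t)%:E)%E.
  by move=> tI; rewrite lee_fin mulr_ge0 ?exprn_even_ge0 ?weight_ge0.
have sV0 t : (0 <= s%:E * ((x - t) `^ (2 * alpha - 2))%:E)%E.
  by rewrite -EFinM lee_fin mulr_ge0 ?powR_ge0.
have msV : measurable_fun `]a, x[ (fun t => s%:E * ((x - t) `^ (2 * alpha - 2))%:E)%E.
  exact: measurable_funeM.
apply: (@le_trans _ _ (\int[mu]_(t in `]a, x[)
    (k%:E * ((u t ^+ 2 * w t)%:E + s%:E * ((x - t) `^ (2 * alpha - 2))%:E)))%E).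
  apply: ae_ge0_le_integral => //.
  - exact: measurableT_comp.
  - by move=> t tI; rewrite mule_ge0 ?adde_ge0 ?uw0//; exact: sub.
  - by apply: measurable_funeM; exact: emeasurable_funD.
  apply: ae_mono u0 => t ut tI; rewrite [leRHS]/= lee_fin.
  move: tI => /=; rewrite in_itv/= => /andP[at_ tx].
  by apply: Volterra_AMGM => // tc; apply: ut; rewrite in_itv/= at_.
rewrite ge0_integralZl//; first last.
- by move=> t tI; rewrite adde_ge0 ?uw0//; exact: sub.
- exact: emeasurable_funD.
rewrite ge0_integralD//; last by move=> t tI; rewrite uw0//; exact: sub.
rewrite ge0_integralZl//; last by move=> t _; rewrite lee_fin powR_ge0.
rewrite EFinM lee_wpmul2l ?lee_fin// /Volterra_const EFinD leeD//.
  by apply: le_trans uN; exact: ge0_subset_integral.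
rewrite EFinM lee_wpmul2l ?lee_fin//.
have p1 : -1 < 2 * alpha - 2 by lra.
apply: le_trans (integral_powR_singular_le p1 ax) _.
have -> : 2 * alpha - 2 + 1 = 2 * alpha - 1 by lra.
rewrite lee_fin ler_pM2r ?invr_gt0; last by lra.
by rewrite ge0_ler_powR ?nnegrE//; lra.
Qed.

(** By [Volterra_bound] the squared modulus of the integral at [x > c] is at most a
    constant times [(b - x)^(- beta)], so its product with [w x] is bounded. *)
Lemma frac_integral_tail f : tail_space a b w c f ->
  tail_space a b w c (frac_integral a alpha f).
Proof.
move=> [fL f0].
have mw : measurable_fun `]a, b[ w by exact: measurable_weight.
have w0 x : x \in `]a, b[ -> 0 <= w x by exact: weight_ge0.
have [[mfr mfi] ffin] := (L2P _ _ _ _).1 fL.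
pose Ir x := \int[mu]_(t in `]a, x[) (complex.Re (f t) * (x - t) `^ (alpha - 1)).
pose Ii x := \int[mu]_(t in `]a, x[) (complex.Im (f t) * (x - t) `^ (alpha - 1)).
have IE x : frac_integral a alpha f x = ((Gamma alpha)^-1)%:C * (Ir x +i* Ii x)%C.
  rewrite /frac_integral /integralC; congr (_ * (_ +i* _)%C);
    apply: eq_Rintegral => t _; case: (f t) => r i /=; ring.
have r0 : {ae mu, forall t, t \in `]a, c[ -> complex.Re (f t) = 0}.
  by apply: ae_mono f0 => t ft /ft ->.
have i0 : {ae mu, forall t, t \in `]a, c[ -> complex.Im (f t) = 0}.
  by apply: ae_mono f0 => t ft /ft ->.
have mI : measurable_funC `]a, b[ (frac_integral a alpha f).
  rewrite (_ : frac_integral _ _ _ = fun x => ((Gamma alpha)^-1)%:C * (Ir x +i* Ii x)%C).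
    by apply: measurable_funC_scale; split; exact: measurable_Volterra.
  by apply/funext.
have I0 (u : R -> R) (x : R) :
    {ae mu, forall t, t \in `]a, c[ -> u t = 0} -> measurable_fun `]a, b[ u ->
    x \in `]a, c] -> \int[mu]_(t in `]a, x[) (u t * (x - t) `^ (alpha - 1)) = 0.
  move=> u0 um; rewrite in_itv/= => /andP[ax xc].
  rewrite /Rintegral (ae_eq_integral (cst 0%E)) ?integral0//.
  - apply/measurable_EFinP/measurable_funM; last exact: measurable_powR_sub.
    apply: measurable_funS um => //; apply: subset_itvl; rewrite bnd_simp.
    by rewrite (le_trans xc)// ltW.
  - apply: ae_mono u0 => t ut tI; rewrite /= ut ?mul0r//.
    by apply: subset_itvl tI; rewrite bnd_simp.
split; last first.
  apply: aeW => x xac; rewrite IE /Ir /Ii !I0 ?mulr0//.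
    by apply: subset_itvl xac; rewrite bnd_simp.
  by apply: subset_itvl xac; rewrite bnd_simp.
pose N := fine (normsq a b w f).
have NE : N%:E = normsq a b w f.
  by rewrite fineK// ge0_fin_numE// normsq_ge0.
have uN (u : R -> R) :
    measurable_fun `]a, b[ u -> (forall t, u t ^+ 2 <= sqc (f t)) ->
    (\int[mu]_(t in `]a, b[) (u t ^+ 2 * w t)%:E <= N%:E)%E.
  move=> um uf; rewrite NE; apply: ge0_le_integral => //.
  - by move=> t tI; rewrite lee_fin mulr_ge0 ?exprn_even_ge0 ?w0.
  - by apply/measurable_EFinP/measurable_funM => //; exact: measurable_funX.
  - by apply: measurable_density => //; split.
  - by move=> t tI; rewrite lee_fin ler_wpM2r ?w0.
have rN : (\int[mu]_(t in `]a, b[) (complex.Re (f t) ^+ 2 * w t)%:E <= N%:E)%E.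
  by apply: uN => // t; rewrite /sqc lerDl sqr_ge0.
have iN : (\int[mu]_(t in `]a, b[) (complex.Im (f t) ^+ 2 * w t)%:E <= N%:E)%E.
  by apply: uN => // t; rewrite /sqc lerDr sqr_ge0.
pose K := Volterra_const N.
pose B := ((Gamma alpha)^-1) ^+ 2 * (K ^+ 2 / 2) * (b - a) `^ beta.
have ab : a < b by exact: lt_trans ac cb.
have K0 : 0 <= K ^+ 2 / 2 by rewrite divr_ge0 // sqr_ge0.
have B0 : 0 <= B by rewrite /B mulr_ge0 ?powR_ge0// mulr_ge0// sqr_ge0.
apply/L2P; split => //; apply: (@le_lt_trans _ _ (\int[mu]_(x in `]a, b[) (cst B%:E x))%E).
  apply: ge0_le_integral => //.
  - exact: density_ge0.
  - exact: measurable_density.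
  - move=> x /=; rewrite in_itv/= => /andP[ax xb]; rewrite lee_fin.
    have [xc|cx] := leP x c.
      by rewrite IE /Ir /Ii !I0 ?in_itv/= ?ax// mulr0 /sqc /= expr0n/= addr0 mul0r.
    rewrite IE sqcM sqc_real -mulrA /B -mulrA ler_wpM2l ?exprn_even_ge0//.
    have xI : x \in `]c, b[ by rewrite in_itv/= cx.
    have Br : `|Ir x| <= (2 * (b - x) `^ (beta / 2))^-1 * K.
      exact: Volterra_bound.
    have Bi : `|Ii x| <= (2 * (b - x) `^ (beta / 2))^-1 * K.
      exact: Volterra_bound.
    have w2 : w x = (x - a) `^ beta * ((b - x) `^ (beta / 2)) ^+ 2.
      rewrite /weight; congr (_ * _).
      rewrite -powR_mulrn ?powR_ge0// -powRrM; congr (_ `^ _); lra.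
    have r_gt0 : 0 < (b - x) `^ (beta / 2) by rewrite powR_gt0// subr_gt0.
    have wx : (x - a) `^ beta <= (b - a) `^ beta.
      by rewrite ge0_ler_powR ?nnegrE//; lra.
    have sq : sqc (Ir x +i* Ii x)%C * ((b - x) `^ (beta / 2)) ^+ 2 <= K ^+ 2 / 2.
      move: r_gt0 Br Bi; set r := (b - x) `^ _ => r_gt0.
      have sqr_le y : `|y| <= (2 * r)^-1 * K -> y ^+ 2 * r ^+ 2 <= K ^+ 2 / 4.
        rewrite mulrC ler_pdivlMr ?mulr_gt0// => yK.
        have y0 : 0 <= `|y| * (2 * r) by rewrite mulr_ge0// mulr_ge0// ltW.
        have := @lerXn2r _ 2 _ _ y0 (le_trans y0 yK) yK.
        rewrite exprMn real_normK ?num_real//; lra.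
      move=> /sqr_le Br /sqr_le Bi.
      rewrite /sqc /=; lra.
    rewrite w2 mulrCA mulrC ler_pM ?powR_ge0 //.
    by rewrite mulr_ge0 ?sqc_ge0 ?exprn_even_ge0.
rewrite (integral_cst mu)//.
have := lebesgue_measure_itv `]a, b[; rewrite /= lte_fin ab -EFinD => muI.
by rewrite [X in (_ * X)%E]muI -EFinM ltry.
Qed.

End kernel_bound.

(** * Normalization constants *)

Section Gamma.
Context {R : realType}.
Local Notation mu := (@lebesgue_measure R).

(** This is [u <= expR u] at [u = t / (2 p)], raised to the power [p]. *)
Lemma powR_le_expR (p t : R) : 0 < p -> 0 < t ->
  t `^ p <= (2 * p) `^ p * expR (t / 2).
Proof.
move=> p0 t0.
have p20 : 0 < 2 * p by rewrite mulr_gt0.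
rewrite [in leLHS](_ : t = (2 * p) * (t / (2 * p))); last first.
  by rewrite mulrC divfK// gt_eqF.
rewrite (@powRM _ (2 * p) (t / (2 * p))) ?divr_ge0 ?(ltW p20) ?(ltW t0)// ler_wpM2l ?powR_ge0//.
have -> : expR (t / 2) = expR (t / (2 * p)) `^ p.
  rewrite -expRM; congr expR; field.
  by rewrite gt_eqF.
rewrite ge0_ler_powR ?nnegrE ?expR_ge0 ?divr_ge0 ?ltW//.
have := expR_ge1Dx (t / (2 * p)); lra.
Qed.

(** [Gamma] is a real-valued integral, equal to 0 when it diverges, so positivity
    also requires finiteness: the integrand is dominated by a multiple of the
    exponential density of rate 1/2. *)
Lemma Gamma_gt0 (s : R) : 1 < s -> 0 < Gamma s.
Proof.
move=> s1; rewrite /Gamma /Rintegral.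
have s0 : 0 < s - 1 by rewrite subr_gt0.
pose f t : R := t `^ (s - 1) * expR (- t).
have mf (D : set R) : measurable_fun D (fun t => (f t)%:E).
  apply/measurable_EFinP; apply: measurable_funTS; apply: measurable_funM.
    exact: measurable_powR.
  by apply: measurableT_comp => //; exact: measurable_expR.
have f0 t : (0 <= (f t)%:E)%E by rewrite lee_fin mulr_ge0 ?powR_ge0 ?expR_ge0.
rewrite fine_gt0//; apply/andP; split.
  rewrite lt_neqAle integral_ge0 ?andbT; last by move=> t _; exact: f0.
  rewrite eq_sym; apply/negP => /eqP int0.
  have : (\int[mu]_(t in `]0%R, +oo[) `|(f t)%:E| = 0)%E.
    by rewrite -int0; apply: eq_integral => t _; rewrite gee0_abs.
  move=> /(ae_eq_integral_abs mu (measurable_itv _) (mf _)).1 [N [mN N0 sN]].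
  have : (mu `]0%R, 1%R[ <= mu N)%E.
    apply: le_measure; rewrite ?inE//; last first.
    move=> t /=; rewrite in_itv/= => /andP[t0 t1]; apply: sN => /=.
    rewrite in_itv/= t0 => /(_ isT) /eqP; rewrite eqe gt_eqF//.
    by rewrite mulr_gt0 ?powR_gt0 ?expR_gt0.
  by rewrite N0 lebesgue_measure_itv/= lte_fin ltr01 sube0 lee_fin ler10.
pose C := (2 * (s - 1)) `^ (s - 1) * 2.
apply: (@le_lt_trans _ _ (\int[mu]_(t in `]0%R, +oo[)
    (C%:E * (exponential_pdf 2^-1 t)%:E))%E).
  apply: ge0_le_integral; [by []|by move=> t _; exact: f0|exact: mf| |].
  - apply: measurable_funeM; apply/measurable_EFinP; apply: measurable_funTS.
    exact: measurable_exponential_pdf.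
  - move=> t /=; rewrite in_itv/= andbT => t0.
    rewrite exponential_pdfE ?(ltW t0)// [leRHS]/= lee_fin.
    apply: (@le_trans _ _ ((2 * (s - 1)) `^ (s - 1) * expR (t / 2) * expR (- t))).
      by rewrite ler_wpM2r ?expR_ge0// powR_le_expR.
    rewrite /C -!mulrA ler_wpM2l ?powR_ge0// -expRD mulrA divff// mul1r.
    by rewrite ler_expR; lra.
rewrite ge0_integralZl//.
- rewrite lte_mul_pinfty ?lee_fin ?mulr_ge0 ?powR_ge0//.
  apply: (@le_lt_trans _ _ (\int[mu]_t (exponential_pdf 2^-1 t)%:E)%E).
    apply: ge0_subset_integral => //.
    + by apply/measurable_EFinP; exact: measurable_exponential_pdf.
    + by move=> t _; rewrite lee_fin exponential_pdf_ge0.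
  by rewrite integral_exponential_pdf// ltry.
- by apply/measurable_EFinP; apply: measurable_funTS; exact: measurable_exponential_pdf.
- by move=> t _; rewrite lee_fin exponential_pdf_ge0.
- by rewrite lee_fin mulr_ge0 ?powR_ge0.
Qed.

Lemma ultra_delta_neq0 (a b beta : R) n : a < b -> 0 < beta ->
  ultra_delta a b beta n != 0.
Proof.
move=> ab beta0; have n0 : 0 <= n%:R :> R by [].
have G1 : 0 < Gamma (2 * beta + n%:R + 1) by apply: Gamma_gt0; lra.
have G2 : 0 < Gamma (beta + n%:R + 1) by apply: Gamma_gt0; lra.
rewrite /ultra_delta; apply: mulf_neq0; first apply: mulf_neq0.
- by rewrite signr_eq0.
- apply: mulf_neq0; first by rewrite gt_eqF// sqrtr_gt0; lra.
  by rewrite invr_eq0 gt_eqF// powR_gt0// subr_gt0.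
by rewrite gt_eqF// sqrtr_gt0 divr_gt0// mulr_gt0 ?exprn_gt0//.
Qed.

End Gamma.

(** * The polynomials of Rodrigues' formula *)

Section Rodrigues_polynomial.
Context {F : numFieldType} (a b : F).
Implicit Types (s : F) (p : {poly F}).

(** The polynomial factor of the derivative of
    [(x - a)^s (b - x)^s p(x)], once [(x - a)^(s - 1) (b - x)^(s - 1)] is
    factored out. *)
Definition Rodrigues_step s p : {poly F} :=
  (s *: ((a + b)%:P - 2 *: 'X)) * p + ('X - a%:P) * (b%:P - 'X) * p^`().

Fixpoint Rodrigues_poly s n : {poly F} :=
  if n is m.+1 then Rodrigues_step (s - m%:R) (Rodrigues_poly s m) else 1.

Let refl : {poly F} := (a + b)%:P - 'X.

(** Differentiating [p] costs one degree and the quadratic factor restores two: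
    each step raises the degree by one, and the new leading coefficient does not
    vanish as long as [2 s + n > 0]. *)
Lemma Rodrigues_step_lead s p n : (size p <= n.+1)%N ->
  (size (Rodrigues_step s p) <= n.+2)%N /\
  (Rodrigues_step s p)`_n.+1 = - (2 * s + n%:R) * p`_n.
Proof.
move=> sp.
have -> : Rodrigues_step s p = (s * (a + b)) *: p - (2 * s) *: ('X * p)
    + ((a + b) *: ('X * p^`()) - 'X * ('X * p^`()) - (a * b) *: p^`()).
  rewrite /Rodrigues_step -!mul_polyC !polyCM !polyCD; ring.
have coef0 i : (n < i)%N -> p`_i = 0.
  by move=> ni; rewrite nth_default// (leq_trans sp).
have coefE' i : (n.+1 <= i)%N ->
  ((s * (a + b)) *: p - (2 * s) *: ('X * p)
    + ((a + b) *: ('X * p^`()) - 'X * ('X * p^`()) - (a * b) *: p^`()))`_i =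
  - (2 * s + i.-1%:R) * p`_i.-1.
  case: i => // i; rewrite ltnS => ni.
  rewrite !(coefD, coefN, coefZ, coefXM, coef_deriv) /=.
  rewrite (coef0 i.+1) ?ltnS// (coef0 i.+2) ?ltnS 1?(leq_trans ni)//.
  case: i ni => [|i] ni /=; first by ring.
  ring.
split; last by rewrite coefE'.
apply/leq_sizeP => i ni; rewrite coefE' 1?ltnW// coef0 ?mulr0//.
by case: i ni.
Qed.

Lemma size_Rodrigues_poly s n : n%:R - 1 < s -> size (Rodrigues_poly s n) = n.+1.
Proof.
move=> ns.
have sle m : (size (Rodrigues_poly s m) <= m.+1)%N.
  by elim: m => [|m IH] /=; [rewrite size_poly1|have [] := Rodrigues_step_lead (s - m%:R) IH].
apply/eqP; rewrite eqn_leq sle /=.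
suff : (Rodrigues_poly s n)`_n != 0.
  by apply: contraR; rewrite -leqNgt => /leq_sizeP/(_ n (leqnn _))/eqP.
have : forall m, (m <= n)%N -> (Rodrigues_poly s m)`_m != 0.
  elim => [_|m IH mn] /=; first by rewrite coef1 oner_eq0.
  have [_ ->] := Rodrigues_step_lead (s - m%:R) (sle m).
  rewrite mulf_neq0 ?IH ?(ltnW mn)// oppr_eq0 gt_eqF//.
  have : m.+1%:R <= n%:R :> F by rewrite ler_nat.
  rewrite -natr1 => mn'.
  have sm : m%:R < s by rewrite (le_lt_trans _ ns)// lerBrDr.
  by rewrite ltr_wpDr// mulr_gt0// subr_gt0.
exact.
Qed.

(** Under the reflection exchanging [a] and [b], [a + b - 2 x] is odd,
    [(x - a) (b - x)] is even, and differentiation reverses parity: each step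
    reverses parity. *)
Lemma Rodrigues_poly_reflect s n :
  Rodrigues_poly s n \Po refl = (-1) ^+ n *: Rodrigues_poly s n.
Proof.
elim: n => [|n IH] /=; first by rewrite comp_polyC expr0 scale1r.
have dIH : (Rodrigues_poly s n)^`() \Po refl = (-1) ^+ n.+1 *: (Rodrigues_poly s n)^`().
  have /(congr1 deriv) := IH; rewrite deriv_comp derivZ derivB derivC derivX sub0r mulrN1.
  by move=> /(congr1 -%R); rewrite opprK => ->; rewrite exprS mulN1r scaleNr.
rewrite /Rodrigues_step comp_polyD !comp_polyM dIH IH.
rewrite !comp_polyZ !comp_polyB !comp_polyC !comp_polyZ !comp_polyX exprS -!mul_polyC.
rewrite /refl !polyCD !polyCM; ring.
Qed.

End Rodrigues_polynomial.

Section Rodrigues_formula.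
Context {R : realType} (a b : R).

Lemma is_derive_Rodrigues s (p : {poly R}) x : x \in `]a, b[ ->
  is_derive x 1 (fun t => (t - a) `^ s * (b - t) `^ s * p.[t])
    ((x - a) `^ (s - 1) * (b - x) `^ (s - 1) * (Rodrigues_step a b s p).[x]).
Proof.
rewrite in_itv/= => /andP[ax xb].
have da : is_derive x 1 (fun t : R => (t - a) `^ s) (s * (x - a) `^ (s - 1)).
  have xa : 0 < x - a by rewrite subr_gt0.
  have dp := @is_derive1_powR R s (x - a) xa.
  have ds : is_derive x 1 (fun t : R => t - a) 1.
    by apply: is_derive_eq; rewrite subr0.
  have := @is_derive1_comp R (fun y => y `^ s) (fun t => t - a) x _ _ dp ds.
  by rewrite mulr1.
have db := is_derive_powR_sub s xb.
have dp : is_derive x 1 (horner p) (p^`()).[x] by exact: is_derive_poly.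
have -> : (fun t => (t - a) `^ s * (b - t) `^ s * p.[t]) =
  (fun t : R => (t - a) `^ s) * (fun t : R => (b - t) `^ s) * (horner p) by [].
apply: is_derive_eq.
rewrite /GRing.scale !fctE /=.
have powR_pred (y : R) : 0 < y -> y `^ s = y `^ (s - 1) * y.
  move=> y0; rewrite -[in LHS](subrK 1 s) [LHS]powRD ?powRr1 ?(ltW y0)//.
  by rewrite (gt_eqF y0) implybT.
rewrite (powR_pred (x - a)) ?subr_gt0// (powR_pred (b - x)) ?subr_gt0//.
have -> : (Rodrigues_step a b s p).[x] =
    s * (a + b - 2 * x) * p.[x] + (x - a) * (b - x) * p^`().[x].
  by rewrite /Rodrigues_step !hornerE.
ring.
Qed.

Lemma derive1n_Rodrigues s n x : x \in `]a, b[ ->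
  derive1n n (fun t => (t - a) `^ s * (b - t) `^ s) x =
  (x - a) `^ (s - n%:R) * (b - x) `^ (s - n%:R) * (Rodrigues_poly a b s n).[x].
Proof.
elim: n x => [|n IH] x xI.
  by rewrite derive1n0 subr0 /= hornerE mulr1.
rewrite derive1nS derive1E (near_eq_derive _ (g := fun t =>
  (t - a) `^ (s - n%:R) * (b - t) `^ (s - n%:R) * (Rodrigues_poly a b s n).[t])).
  have [_ ->] := is_derive_Rodrigues (s - n%:R) (Rodrigues_poly a b s n) xI.
  by rewrite -natr1 opprD addrA.
near=> t; apply: IH; near: t.
exact: near_in_itvoo.
Unshelve. all: by end_near. Qed.

Definition ultra_poly (beta : R) n : {poly R} := Rodrigues_poly a b (beta + n%:R) n.

Lemma ultra_yE beta n x : x \in `]a, b[ ->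
  ultra_y a b beta n x = (ultra_poly beta n).[x].
Proof.
move=> xI; rewrite /ultra_y derive1n_Rodrigues// addrK.
move: xI; rewrite in_itv/= => /andP[ax xb].
rewrite !powRN mulrA mulrACA mulVf ?mulVf ?mul1r//.
  by rewrite gt_eqF// powR_gt0// subr_gt0.
by rewrite gt_eqF// powR_gt0// subr_gt0.
Qed.

End Rodrigues_formula.

(** * Closed subspaces containing the ultraspherical polynomials of one parity *)

Section polynomials_in_closed_subspaces.
Context {R : realType} (a b beta : R).
Local Notation w := (weight a b beta).
Local Notation refl := ((a + b)%:P - 'X : {poly R}).
Hypothesis ab : a < b.
Hypothesis beta_gt0 : 0 < beta.

Lemma measurable_horner (p : {poly R}) (D : set R) : measurable_fun D (horner p).
Proof.
apply: measurable_funTS; apply: continuous_measurable_fun.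
exact: continuous_horner.
Qed.

Lemma closed_subspace_ultra_poly M n : closed_subspace a b w M ->
  M (ultra_p a b beta n) -> M (fun x => ((ultra_poly a b beta n).[x])%:C).
Proof.
move=> Mcl Mp; have [_ _ _ MZ _] := Mcl.
have d0 := ultra_delta_neq0 n ab beta_gt0.
have w0 x : x \in `]a, b[ -> 0 <= w x by exact: weight_ge0.
apply: (closed_subspace_eqI w0 _ Mcl (MZ ((ultra_delta a b beta n)^-1)%:C _ Mp)).
- exact: measurable_weight.
- by apply: measurable_funC_real; exact: measurable_horner.
- move=> x xI; rewrite /ultra_p ultra_yE// -rmorphM /=.
  by rewrite mulrA mulVf// mul1r.
Qed.

Lemma size_refl : size refl = 2.
Proof. by rewrite -opprB size_polyN size_XsubC. Qed.

Lemma lead_coef_refl : lead_coef refl = -1.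
Proof. by rewrite -opprB lead_coefN lead_coefXsubC. Qed.

(** The reflection multiplies the leading coefficient of a polynomial of degree [d]
    by [(-1)^d]. *)
Lemma parity_of_degree (p : {poly R}) (e : bool) : p != 0 ->
  p \Po refl = (-1) ^+ e *: p -> odd (size p).-1 = e.
Proof.
move=> p0 /(congr1 lead_coef).
rewrite lead_coef_comp ?size_refl// lead_coef_refl lead_coefZ mulrC.
move=> /(mulIf _); rewrite lead_coef_eq0 => /(_ p0).
rewrite -(signr_odd _ (size p).-1); case: (odd _); case: e => //= /eqP.
  by rewrite ?expr1 ?expr0 eq_sym -subr_eq0 opprK (_ : 1 + 1 = 2%:R)// pnatr_eq0.
by rewrite ?expr1 ?expr0 -subr_eq0 opprK (_ : 1 + 1 = 2%:R)// pnatr_eq0.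
Qed.

(** Induction on the degree: a polynomial of parity [e] has a degree [k] of the same
    parity, so the [k]-th ultraspherical polynomial is available to cancel its
    leading term, and the difference is again of parity [e]. *)
Lemma closed_subspace_poly M (e : bool) : closed_subspace a b w M ->
  (forall n, odd n = e -> M (ultra_p a b beta n)) ->
  forall p : {poly R}, p \Po refl = (-1) ^+ e *: p -> M (fun x => (p.[x])%:C).
Proof.
move=> Mcl Mp p; have [_ M0 MD MZ _] := Mcl.
move: {2}(size p) (leqnn (size p)) => k.
elim: k p => [p|k IH p pk pe].
  rewrite leqn0 size_poly_eq0 => /eqP -> _.
  by rewrite (_ : (fun _ => _) = fun=> 0)//; apply/funext => x; rewrite horner0.
have [pk'|kp] := leqP (size p) k; first exact: IH.
have sp : size p = k.+1 by apply/eqP; rewrite eqn_leq pk kp.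
have p0 : p != 0 by rewrite -size_poly_gt0 sp.
have ke : odd k = e by rewrite -(parity_of_degree p0 pe) sp.
pose q := ultra_poly a b beta k.
have sq : size q = k.+1 by rewrite size_Rodrigues_poly//; move: beta_gt0; lra.
have q0 : lead_coef q != 0 by rewrite lead_coef_eq0 -size_poly_gt0 sq.
have qe : q \Po refl = (-1) ^+ e *: q.
  by rewrite Rodrigues_poly_reflect -signr_odd ke.
pose c := lead_coef p / lead_coef q.
have pE : p = (p - c *: q) + c *: q by rewrite subrK.
rewrite (_ : (fun x => _) =
    fun x => ((p - c *: q).[x])%:C + c%:C * (q.[x])%:C); last first.
  by apply/funext => x; rewrite {1}pE hornerD hornerZ rmorphD rmorphM.
apply: MD; last by apply: MZ; apply: closed_subspace_ultra_poly => //; exact: Mp.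
apply: IH; last first.
  by rewrite comp_polyB comp_polyZ pe qe scalerBr !scalerA mulrC.
apply/leq_sizeP => i; rewrite leq_eqVlt => /predU1P[<-|ki].
  rewrite coefB coefZ.
  have -> : q`_k = lead_coef q by rewrite lead_coefE sq.
  by rewrite divfK// lead_coefE sp subrr.
by rewrite coefB coefZ !nth_default ?sp ?sq// mulr0 subrr.
Qed.

End polynomials_in_closed_subspaces.

(** * Uniform approximation of the bumps *)

Section absolute_value_approximation.
Context {R : realType}.

(** The classical iteration for the square root of [y^2], which increases to [|y|]
    on [-1, 1]. *)
Fixpoint abs_poly n : {poly R} :=
  if n is m.+1 then abs_poly m + 2^-1 *: ('X ^+ 2 - abs_poly m ^+ 2) else 0.

(** The error [d_n = |y| - P_n(y)] satisfies
    [d_(n+1) = d_n (1 - (|y| + P_n(y)) / 2) <= d_n (1 - d_n / 2)], and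
    [d_n (n + 1) <= 2] follows by induction. *)
Lemma abs_poly_bounds n (y : R) : `|y| <= 1 ->
  [/\ 0 <= (abs_poly n).[y], (abs_poly n).[y] <= `|y| &
      (`|y| - (abs_poly n).[y]) * n.+1%:R <= 2].
Proof.
move=> y1; have y0 : 0 <= `|y| by [].
elim: n => [|n [P0 Py Pn]] /=.
  by rewrite horner0 subr0 mulr1; split => //; lra.
have -> : (abs_poly n + 2^-1 *: ('X ^+ 2 - abs_poly n ^+ 2)).[y] =
    (abs_poly n).[y] + 2^-1 * (`|y| ^+ 2 - (abs_poly n).[y] ^+ 2).
  by rewrite !hornerE real_normK// num_real.
move: y0 y1 P0 Py Pn; rewrite -(natr1 n.+1).
set P := (abs_poly n).[y]; set u := `|y|; set N := n.+1%:R => u0 u1 P0 Py Pn.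
have N0 : 0 < N by rewrite ltr0n.
have uP : 0 <= (u - P) * (u + P) by rewrite mulr_ge0 ?subr_ge0 ?addr_ge0.
have uP2 : 0 <= (u - P) * (2 - u - P) by rewrite mulr_ge0 ?subr_ge0//; lra.
split; [lra|lra|].
pose d := u - P.
have d0 : 0 <= d by rewrite subr_ge0.
have d1 : d <= 1 by rewrite /d; lra.
have step : u - (P + 2^-1 * (u ^+ 2 - P ^+ 2)) <= d * (1 - d / 2).
  suff : 0 <= (u - P) * P by rewrite /d; lra.
  by rewrite mulr_ge0 ?subr_ge0.
have : d * (1 - d / 2) * (N + 1) <= 2.
  (* The difference of the two sides is this product plus [d^2 / 2]. *)
  have : 0 <= (2 - d * N) * (1 - d / 2).
    by rewrite mulr_ge0 ?subr_ge0//; lra.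
  have := sqr_ge0 d; lra.
apply: le_trans; rewrite ler_wpM2r//; lra.
Qed.

End absolute_value_approximation.

(** For [e = 0] this is an even bump about [m], for [e = 1] an odd one. *)
Definition bump {R : realType} (m r : R) (e : nat) (x : R) : R :=
  (x - m) ^+ e * Num.max (r ^+ 2 - (x - m) ^+ 2) 0.

Section bump.
Context {R : realType} (a b beta : R).
Implicit Types (r x : R) (e n : nat).
Local Notation mu := (@lebesgue_measure R).
Local Notation w := (weight a b beta).
Local Notation refl := ((a + b)%:P - 'X : {poly R}).
Local Notation m := ((a + b) / 2).
Local Notation h := ((b - a) / 2).
Hypothesis ab : a < b.
Hypothesis beta_gt0 : 0 < beta.

Let w_ge0 x : x \in `]a, b[ -> 0 <= w x. Proof. exact: weight_ge0. Qed.
Let mw : measurable_fun `]a, b[ w. Proof. exact: measurable_weight. Qed.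
Let w_le x : x \in `]a, b[ -> w x <= (b - a) `^ beta * (b - a) `^ beta.
Proof. by apply: weight_le; exact: ltW. Qed.

Lemma measurable_bump r e (D : set R) : measurable_fun D (bump m r e).
Proof.
apply: measurable_funTS; apply: measurable_funM.
  by apply: measurable_funX; exact: measurable_funB.
apply: measurable_maxr => //; apply: measurable_funB => //.
by apply: measurable_funX; exact: measurable_funB.
Qed.

(** With [y = r^2 - (x - m)^2], the bump is [(x - m)^e (y + |y|) / 2]; as
    [|y| <= h^2] on I for [r <= h], rescaling by [h^2] brings [y] in the range where
    [abs_poly] approximates the absolute value. *)
Definition bump_poly r (e n : nat) : {poly R} :=
  let y := (r ^+ 2)%:P - ('X - m%:P) ^+ 2 in
  ('X - m%:P) ^+ e *
    (2^-1 *: (y + (h ^+ 2) *: (abs_poly n \Po ((h ^+ 2)^-1 *: y)))).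

Lemma bump_poly_reflect r (e n : nat) :
  bump_poly r e n \Po refl = (-1) ^+ e *: bump_poly r e n.
Proof.
set z : {poly R} := 'X - m%:P.
have zr : z \Po refl = - z.
  rewrite /z comp_polyB comp_polyX comp_polyC.
  have -> : (a + b)%:P = m%:P + m%:P by rewrite -polyCD; congr (_%:P); lra.
  by ring.
have cX p k : (p ^+ k) \Po refl = (p \Po refl) ^+ k by exact: rmorphXn.
rewrite /bump_poly -/z; set y := _ - z ^+ 2.
have yr : y \Po refl = y.
  by rewrite /y comp_polyB comp_polyC cX zr sqrrN.
rewrite comp_polyM cX zr comp_polyZ comp_polyD comp_polyZ.
rewrite -comp_polyA comp_polyZ yr (exprNn z) -mulrA.
rewrite -[in LHS]signr_odd -[in RHS]signr_odd; case: (odd e).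
  by rewrite !expr1 scaleN1r mulN1r.
by rewrite !expr0 scale1r mul1r.
Qed.

Lemma bump_approx r e n x : 0 <= r -> r <= h -> x \in `]a, b[ ->
  (bump m r e x - (bump_poly r e n).[x]) ^+ 2 <= (h ^+ e * h ^+ 2) ^+ 2 / n.+1%:R.
Proof.
move=> r0 rh; rewrite in_itv/= => /andP[ax xb].
have h0 : 0 < h by rewrite divr_gt0 ?subr_gt0.
have zh : `|x - m| <= h by rewrite ler_norml; apply/andP; split; lra.
set z := x - m in zh *; set y := r ^+ 2 - z ^+ 2.
have L0 : 0 < h ^+ 2 by rewrite exprn_gt0.
have rL : r ^+ 2 <= h ^+ 2 by rewrite lerXn2r ?nnegrE// ltW.
have zL : z ^+ 2 <= h ^+ 2.
  by rewrite -[z ^+ 2]real_normK ?num_real// lerXn2r ?nnegrE// ltW.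
have yL : `|(h ^+ 2)^-1 * y| <= 1.
  rewrite normrM gtr0_norm ?invr_gt0// ler_pdivrMl// mulr1 ler_norml /y.
  by have := sqr_ge0 r; have := sqr_ge0 z => *; apply/andP; split; lra.
have [P0 Py Pn] := abs_poly_bounds n yL.
have -> : (bump_poly r e n).[x] =
    z ^+ e * (2^-1 * (y + h ^+ 2 * (abs_poly n).[(h ^+ 2)^-1 * y])).
  by rewrite /bump_poly /= !(hornerE, horner_comp, horner_exp) /= -/z -/y.
have -> : bump m r e x = z ^+ e * (2^-1 * (y + `|y|)).
  by rewrite /bump -/z -/y maxr_absE subr0 addr0 [_ / 2]mulrC.
have yE : `|y| = h ^+ 2 * `|(h ^+ 2)^-1 * y|.
  by rewrite normrM (@gtr0_norm _ (h ^+ 2)^-1) ?invr_gt0// mulVKf// gt_eqF.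
rewrite yE; set u := `|_ * y|in Py Pn *; set P := _.[_] in P0 Py Pn *.
rewrite (_ : _ - _ = z ^+ e * h ^+ 2 * ((u - P) / 2)); last by ring.
rewrite exprMn; set N := n.+1%:R in Pn *.
have N1 : 1 <= N by rewrite ler1n.
have N0 : 0 < N by rewrite ltr0n.
apply: ler_pM; rewrite ?sqr_ge0//.
  have zeh : `|z ^+ e * h ^+ 2| <= h ^+ e * h ^+ 2.
    rewrite normrM (gtr0_norm L0) ler_pM2r// normrX.
    by rewrite lerXn2r ?nnegrE ?normr_ge0 ?(ltW h0).
  rewrite -[leLHS]real_normK ?num_real// lerXn2r ?nnegrE ?normr_ge0//.
  exact: le_trans zeh.
have d0 : 0 <= (u - P) / 2 by rewrite divr_ge0 ?subr_ge0.
have dN : (u - P) / 2 * N <= 1 by lra.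
rewrite -[leRHS]mul1r ler_pdivlMr//.
set d := (u - P) / 2 in d0 dN *.
have : d ^+ 2 * N <= d by rewrite expr2 -mulrA -[leRHS]mulr1 ler_wpM2l.
have : d <= d * N by rewrite -[leLHS]mulr1 ler_wpM2l.
lra.
Qed.

Lemma normr_bump_le r e x : 0 <= r -> r <= h -> x \in `]a, b[ ->
  `|bump m r e x| <= h ^+ e * h ^+ 2.
Proof.
move=> r0 rh; rewrite in_itv/= => /andP[ax xb].
have h0 : 0 < h by rewrite divr_gt0 ?subr_gt0.
have zh : `|x - m| <= h by rewrite ler_norml; apply/andP; split; lra.
rewrite /bump normrM normrX ler_pM ?exprn_ge0//.
  by rewrite lerXn2r ?nnegrE// ltW.
have rL : r ^+ 2 <= h ^+ 2 by rewrite lerXn2r ?nnegrE// ltW.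
rewrite ger0_norm ?le_max ?lexx ?orbT// ge_max exprn_ge0 ?(ltW h0)// andbT.
by have := sqr_ge0 (x - m); lra.
Qed.

Lemma L2_bump r e : 0 <= r -> r <= h -> L2 a b w (fun x => (bump m r e x)%:C).
Proof.
move=> r0 rh.
apply: (L2_bounded ab w_ge0 mw w_le (K := (h ^+ e * h ^+ 2) ^+ 2)).
  by apply: measurable_funC_real; exact: measurable_bump.
move=> x xI; rewrite sqc_real -[leLHS]real_normK ?num_real//.
have bx := normr_bump_le e r0 rh xI.
by rewrite lerXn2r ?nnegrE// (le_trans _ bx).
Qed.

Lemma closed_subspace_bump M (e : bool) r : 0 <= r -> r <= h ->
  closed_subspace a b w M -> (forall n, odd n = e -> M (ultra_p a b beta n)) ->
  M (fun x => (bump m r e x)%:C).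
Proof.
move=> r0 rh Mcl Mp.
apply: (closed_subspace_uniform ab w_ge0 mw w_le Mcl); first exact: L2_bump.
move=> eps eps0; pose C := (h ^+ e * h ^+ 2) ^+ 2.
pose n := Num.truncn (C / eps).
exists (fun x => ((bump_poly r e n).[x])%:C).
  by apply: (closed_subspace_poly ab beta_gt0 Mcl Mp); exact: bump_poly_reflect.
move=> x xI; rewrite -rmorphB sqc_real.
apply: le_trans (bump_approx e n r0 rh xI) _.
rewrite ler_pdivrMr ?ltr0n// [leRHS]mulrC -ler_pdivrMr// ltW//.
exact: truncnS_gt.
Qed.

Lemma bump_in_L2_plus r : 0 <= r -> r <= h ->
  L2_plus a b beta (fun x => (bump m r 0 x)%:C).
Proof.
move=> r0 rh; split; first exact: L2_bump.
move=> M Mcl MS; apply: (@closed_subspace_bump M false) => // n on.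
by apply: MS; exists n./2 => //; rewrite -[in RHS](odd_double_half n) on.
Qed.

Lemma bump_in_L2_minus r : 0 <= r -> r <= h ->
  L2_minus a b beta (fun x => (bump m r 1 x)%:C).
Proof.
move=> r0 rh; split; first exact: L2_bump.
move=> M Mcl MS; apply: (@closed_subspace_bump M true) => // n on.
by apply: MS; exists n./2 => //; rewrite -[in RHS](odd_double_half n) on.
Qed.

Lemma bump_in_tail_space r e : 0 <= r -> r <= h ->
  tail_space a b w (m - r) (fun x => (bump m r e x)%:C).
Proof.
move=> r0 rh; split; first exact: L2_bump.
apply: aeW => x; rewrite in_itv/= => /andP[_ xr].
rewrite /bump max_r ?mulr0// subr_le0 -[leRHS]sqrrN lerXn2r ?nnegrE//; lra.
Qed.

Lemma bump_neq0 r e x : x \in `]m - r, m[ -> (bump m r e x)%:C != 0 :> R[i].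
Proof.
rewrite in_itv/= => /andP[rx xm].
rewrite -(rmorph0 (real_complex R)) (inj_eq (@complexI _)).
apply: mulf_neq0; first by rewrite expf_neq0// subr_eq0 lt_eqF.
rewrite gt_eqF// lt_max subr_gt0 -[ltLHS]sqrrN.
by rewrite ltrXn2r ?nnegrE//; lra.
Qed.

End bump.

(** * The chain of invariant subspaces *)

Unset Implicit Arguments.

Theorem theorem3 (R : realType) (a b alpha beta : R)
    (hab : a < b)
    (halpha1 : 1 / 2 < alpha) (halpha2 : alpha < 3 / 2)
    (hbeta1 : alpha - 1 / 2 < beta) (hbeta2 : beta < 1) :
  non_simple a b (weight a b beta) (frac_integral a alpha) \/
  exists M : nat -> set (R -> R[i]),
    [/\ forall k,
          invariant_subspace a b (weight a b beta) (frac_integral a alpha)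
            (M k),
        forall k, M k.+1 `<` M k &
        forall k, nonzero a b (M k `&` L2_plus a b beta) /\
                  nonzero a b (M k `&` L2_minus a b beta)].
Proof.
right.
have beta0 : 0 < beta by lra.
pose m := (a + b) / 2; pose h := (b - a) / 2.
have h0 : 0 < h by rewrite divr_gt0// subr_gt0.
pose r (k : nat) : R := h / k.+2%:R.
have r0 k : 0 < r k by rewrite divr_gt0.
have rh k : r k < h by rewrite ltr_pdivrMr// ltr_pMr// ltr1n.
have rS k : r k.+1 < r k by rewrite ltr_pM2l// ltf_pV2 ?posrE// ltr_nat.
have ac k : a < m - r k by have := rh k; rewrite /m /h; lra.
have cb k : m - r k < b by have := r0 k; rewrite /m; lra.
exists (fun k => tail_space a b (weight a b beta) (m - r k)); split.
- move=> k; split.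
    apply: tail_space_closed; [exact: weight_gt0|exact: measurable_weight|exact: ltW].
  by move=> f; apply: frac_integral_tail => //; exact: ltW.
- move=> k; split.
    by apply: tail_spaceS; rewrite lerD2l lerN2 ltW.
  move=> /(_ _ (bump_in_tail_space hab beta0 0 (ltW (r0 k)) (ltW (rh k))))[_].
  apply: (@not_ae_on_interval _ (m - r k) (m - r k.+1)); first by rewrite ltrD2l ltrN2.
  move=> x; rewrite in_itv/= => /andP[rx xr] bx0.
  have /bx0 /eqP : x \in `]a, (m - r k.+1)[ by rewrite in_itv/= (lt_trans (ac k) rx).
  apply/negP; apply: (@bump_neq0 _ _ _ (r k)).
  by rewrite in_itv/=; apply/andP; split; last by rewrite (lt_trans xr)// gtrBl.
- move=> k; have rk0 := ltW (r0 k); have rkh := ltW (rh k).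
  have nz e : ~ ae_eqI a b (fun x => (bump m (r k) e x)%:C) (fun=> 0).
    apply: (@not_ae_on_interval _ (m - r k) m); first by rewrite gtrBl.
    move=> x xI bx0.
    have /bx0 /eqP : x \in `]a, b[.
      move: xI; rewrite !in_itv/= => /andP[rx xm].
      by rewrite (lt_trans (ac k) rx) (lt_trans xm)// /m; lra.
    by apply/negP; exact: bump_neq0.
  split.
  + exists (fun x => (bump m (r k) 0 x)%:C) => //.
    by split; [exact: bump_in_tail_space|exact: bump_in_L2_plus].
  + exists (fun x => (bump m (r k) 1 x)%:C) => //.
    by split; [exact: bump_in_tail_space|exact: bump_in_L2_minus].
Qed.
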